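(* Let $G$ be a weakly connected graph (finite edge-labelled acyclic directed multigraph), and let $X_1$, $X_2$ and $Y=V(G)\setminus (X_1\cup X_2)$ be three disjoint nonempty subsets of $V(G)$. Suppose that $G\{[X_1,Y]\}$ (with its ends in $X_1$ and its ends in $Y$ as partite sets) is a clean bipartite subgraph of $G$, that $G\{[Y,X_2]\}$ (with its ends in $Y$ and its ends in $X_2$ as partite sets) is a clean bipartite subgraph of $G$, that the arcs of $[X_1,X_2]$ have no label pairs in common with any arc in $[X_1,Y]\cup[Y,X_2]$, and that the arcs of $G/X_1/X_2$ and $G/Y$ corresponding to the arcs of $[X_1,Y]\cup [Y,X_2]\cup [X_1,X_2]$ are the only synchronising arcs of $G/X_1/X_2$ and $G/Y$ (with respect to each other). If $S'(G)\subseteq X_1$, and $[X_1,Y]$, $[Y,X_2]$ and $[X_1,X_2]$ have no backward arcs, then $$G\cong \mathrm{VRSP}(G/Y,\,G/X_1/X_2).$$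
   Context: **Graphs.** A graph $G$ is a finite edge-labelled acyclic directed multigraph: a vertex set $V(G)$, an arc set $A(G)$, a set $L(G)$ of label pairs (the label pairs carried by arcs of $G$), an incidence map $\mu:A(G)\to V(G)\times V(G)$, where $\mu(a)=(u,v)$ means that $a$ has tail $u$ and head $v$ (its two ends), and a labelling $\lambda:A(G)\to L(G)$, where $\lambda(a)=(\ell(a),t(a))$ consists of a string $\ell(a)$ and a positive real $t(a)$. Two different arcs with the same tail and the same head are assumed to have different label pairs; whenever a construction produces several arcs with the same tail, head and label pair, they are replaced by a single one. $G$ is weakly connected if its underlying undirected graph is connected. $S'(G)$ is the set of vertices of in-degree $0$. **Levels.** $S^0(G)=S'(G)$; $S^1(G)$ is the set of vertices of in-degree $0$ after deleting $S^0(G)$ and all arcs with tail in $S^0(G)$; and so on. A vertex in $S^j(G)$ is at level $j$. In particular, level $0$ means in-degree $0$. **Arcs between sets.** For disjoint nonempty $X,Y\subseteq V(G)$, $[X,Y]$ is the set of arcs with one end in $X$ and the other in $Y$; such an arc is forward if its head is in $Y$ and backward otherwise. For a set $A'$ of arcs, $G\{A'\}$ is the arc-induced subgraph, with arc set $A'$ and with vertices the ends of arcs of $A'$. **Clean bipartite graphs.** A graph is bipartite, written $B(V_1,V_2)$, if its vertex set is partitioned into nonempty sets $V_1,V_2$ such that every arc has its ends in different sets. It is complete if for all $x\in V_1$, $y\in V_2$ there is an arc with $\mu(a)=(x,y)$ or $\mu(a)=(y,x)$. $B(V_1,V_2)$ is clean if (i) for every label pair occurring on its arcs, the subgraph arc-induced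 by all arcs with that label pair is a complete bipartite graph $B(V_1',V_2')$ with $V_1'\subseteq V_1$, $V_2'\subseteq V_2$, and (ii) $[V_1,V_2]$ has no backward arcs or $[V_1,V_2]$ has no forward arcs. **Contraction.** For a nonempty proper subset $X$ of $V(G)$, $G/X$ is obtained by replacing $X$ by a new vertex $\tilde x$, deleting all arcs with both ends in $X$, and replacing each arc with exactly one end in $X$ by an arc with the same label pair in which that end is replaced by $\tilde x$. $G/X_1/X_2$ denotes $(G/X_1)/X_2$. **Synchronising arcs.** For graphs $G_1,G_2$, an arc $a$ of $G_1$ is synchronising with respect to $G_2$ if some arc $b$ of $G_2$ has $\lambda(b)=\lambda(a)$; similarly with the roles exchanged. **Products.** Let $G_1,G_2$ be graphs. The Cartesian product $G_1\,\Box\,G_2$ has vertex set $V(G_1)\times V(G_2)$; each arc $a\in A(G_1)$ with $\mu(a)=(v_1,w_1)$ and each $v_2\in V(G_2)$ give an arc from $(v_1,v_2)$ to $(w_1,v_2)$ with label pair $\lambda(a)$, and each arc $a\in A(G_2)$ with $\mu(a)=(v_2,w_2)$ and each $v_1\in V(G_1)$ give an arc from $(v_1,v_2)$ to $(v_1,w_2)$ with label pair $\lambda(a)$. The intermediate product $G_1\boxtimes G_2$ has the same vertex set; its arcs are the arcs of $G_1\,\Box\,G_2$ arising from non-synchronising arcs of $G_1$ or $G_2$ (label pair not in $L(G_2)$, respectively $L(G_1)$), together with, for each pair $a_1\in A(G_1)$, $a_2\in A(G_2)$ with $\lambda(a_1)=\lambda(a_2)$, $\mu(a_1)=(v_1,w_1)$,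 $\mu(a_2)=(v_2,w_2)$, an arc from $(v_1,v_2)$ to $(w_1,w_2)$ with label pair $\lambda(a_1)$. The vertex-removing synchronised product $\mathrm{VRSP}(G_1,G_2)$ is obtained from $G_1\boxtimes G_2$ by removing every vertex that has level $0$ in the current graph but level $>0$ in $G_1\,\Box\,G_2$, together with all arcs with that vertex as tail, and repeating this until no such vertices remain. **Isomorphism.** $G\cong H$ means there is a bijection $\phi:V(G)\to V(H)$ such that for all $u,v\in V(G)$ and every label pair, there is an arc $a\in A(G)$ with $\mu(a)=(u,v)$ and that label pair if and only if there is an arc $b\in A(H)$ with $\mu(b)=(\phi(u),\phi(v))$ and that label pair. *)

(* Defs.v *)
From Stdlib Require Import Ascii String.
From HB Require Import structures.
From mathcomp Require Import all_boot all_order all_algebra.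
From mathcomp Require Import reals.

Set Implicit Arguments.
Unset Strict Implicit.
Unset Printing Implicit Defensive.

Import Order.TTheory GRing.Theory Num.Theory.

Definition string_code (s : string) : seq nat :=
  [seq nat_of_ascii c | c <- list_ascii_of_string s].

Definition string_decode (s : seq nat) : string :=
  string_of_list_ascii [seq ascii_of_nat n | n <- s].

Lemma string_codeK : cancel string_code string_decode.
Proof.
move=> s; rewrite /string_decode /string_code -map_comp.
rewrite (@eq_map _ _ _ id) ?map_id ?string_of_list_ascii_of_string //.
exact: ascii_nat_embedding.
Qed.

HB.instance Definition _ := Countable.copy string (can_type string_codeK).

Definition label (R : realType) : Type := (string * {t : R | (0 < t)%R})%type.
HB.instance Definition _ (R : realType) := Choice.on (label R).

(* Acyclicity is kept apart, as the predicate [acyclic], because a contraction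
   of an acyclic graph can have directed cycles. *)
Record lgraph (R : realType) := LGraph {
  vertex : finType;
  garc : finType;
  mu : garc -> vertex * vertex;
  lam : garc -> label R;
  mu_lam_inj : injective (fun a => (mu a, lam a))
}.

Section Graphs.
Variable R : realType.
Implicit Type G : lgraph R.

Definition gtail G (a : garc G) : vertex G := (mu a).1.
Definition ghead G (a : garc G) : vertex G := (mu a).2.

Definition adj G : rel (vertex G) := fun u v => [exists a, mu a == (u, v)].

Definition acyclic G : Prop :=
  forall c : seq (vertex G), c != [::] -> ~~ cycle (@adj G) c.

Definition weakly_connected G : Prop :=
  forall u v : vertex G, connect (fun x y => adj x y || adj y x) u v.

Definition indeg G (v : vertex G) : nat := #|[set a : garc G | ghead a == v]|.

Definition sources G : {set vertex G} := [set v | indeg v == 0].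

Section Merge.
Variables (V I : finType) (P : pred I) (f : I -> (V * V) * label R).

(* The graph on [V] with one arc for each distinct value (ends, label pair)
   taken by the family [f] on [P]: arcs of the family with the same tail, head
   and label pair are identified. *)
Definition merge_arc : finType := seq_sub (image f P).

Fact merge_inj : injective (fun a : merge_arc => ((val a).1, (val a).2)).
Proof. by move=> a b /=; rewrite -!surjective_pairing => /val_inj. Qed.

Definition merge : lgraph R := LGraph merge_inj.
End Merge.

Section Induced.
Variables (G : lgraph R) (K : {set vertex G}).

Definition ind_arc : finType := {a : garc G | (gtail a \in K) && (ghead a \in K)}.

Definition ind_mu (a : ind_arc) : {v | v \in K} * {v | v \in K} :=
  (exist _ (gtail (val a)) (proj1 (andP (valP a))),
   exist _ (ghead (val a)) (proj2 (andP (valP a)))).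

Definition ind_lam (a : ind_arc) : label R := lam (val a).

Fact ind_inj : injective (fun a => (ind_mu a, ind_lam a)).
Proof.
move=> a b [et eh el]; apply/val_inj/(@mu_lam_inj _ G) => /=.
by congr (_, _); rewrite // [LHS]surjective_pairing [RHS]surjective_pairing;
  congr (_, _).
Qed.

Definition induced : lgraph R := LGraph ind_inj.
End Induced.

Section ArcInduced.
Variables (G : lgraph R) (A : {set garc G}).

Definition ends : {set vertex G} := [set gtail a | a in A] :|: [set ghead a | a in A].

Fact tail_ends (a : {a | a \in A}) : gtail (val a) \in ends.
Proof. by rewrite inE imset_f ?(valP a). Qed.

Fact head_ends (a : {a | a \in A}) : ghead (val a) \in ends.
Proof. by rewrite inE orbC imset_f ?(valP a). Qed.

Definition ai_mu (a : {a | a \in A}) : {v | v \in ends} * {v | v \in ends} :=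
  (exist _ (gtail (val a)) (tail_ends a), exist _ (ghead (val a)) (head_ends a)).

Definition ai_lam (a : {a | a \in A}) : label R := lam (val a).

Fact ai_inj : injective (fun a => (ai_mu a, ai_lam a)).
Proof.
move=> a b [et eh el]; apply/val_inj/(@mu_lam_inj _ G) => /=.
by congr (_, _); rewrite // [LHS]surjective_pairing [RHS]surjective_pairing;
  congr (_, _).
Qed.

Definition arc_induced : lgraph R := LGraph ai_inj.
End ArcInduced.

(* [from_level G j] is the set of vertices left after deleting
   S^0(G), ..., S^(j-1)(G).  The vertices of S^j have no incoming arc from the
   vertices left, so deleting them with the arcs having their tail in S^j leaves
   an induced subgraph. *)
Fixpoint from_level G (j : nat) : {set vertex G} :=
  if j is i.+1 then
    from_level G i :\: [set val v | v in sources (induced (from_level G i))]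
  else setT.

Definition level_set G (j : nat) : {set vertex G} :=
  [set val v | v in sources (induced (from_level G j))].

(* The j with v in S^j(G).  Such a j exists, and is less than the number of
   vertices, when [G] is acyclic; a vertex without a level gets the default
   value #|vertex G|. *)
Definition level G (v : vertex G) : nat :=
  find (fun j => v \in level_set G j) (iota 0 #|vertex G|).

Definition between G (X Y : {set vertex G}) : {set garc G} :=
  [set a | (gtail a \in X) && (ghead a \in Y) || (gtail a \in Y) && (ghead a \in X)].

Definition no_backward G (X Y : {set vertex G}) : Prop :=
  forall a, a \in between X Y -> ghead a \in Y.

Definition no_forward G (X Y : {set vertex G}) : Prop :=
  forall a, a \in between X Y -> ghead a \notin Y.

Definition bipartite G (V1 V2 : {set vertex G}) : Prop :=
  [/\ V1 != set0, V2 != set0, V1 :|: V2 = setT, [disjoint V1 & V2]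
    & forall a : garc G, (gtail a \in V1) != (ghead a \in V1)].

Definition complete_bipartite G (V1 V2 : {set vertex G}) : Prop :=
  bipartite V1 V2 /\
  forall x y, x \in V1 -> y \in V2 ->
    exists a : garc G, mu a = (x, y) \/ mu a = (y, x).

Definition label_arcs G (l : label R) : {set garc G} := [set a | lam a == l].

Definition clean G (V1 V2 : {set vertex G}) : Prop :=
  [/\ bipartite V1 V2,
      forall a : garc G, let H := arc_induced (label_arcs G (lam a)) in
        exists V1' V2' : {set vertex H},
          [/\ complete_bipartite V1' V2',
              [set val v | v in V1'] \subset V1
            & [set val v | v in V2'] \subset V2]
    & no_backward V1 V2 \/ no_forward V1 V2].

(* [G{[X, Y]}] is clean, its partite sets being its vertices in [X] and its
   vertices in [Y]. *)
Definition clean_between G (X Y : {set vertex G}) : Prop :=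
  let H := arc_induced (between X Y) in
  @clean H [set v | val v \in X] [set v | val v \in Y].

Section Contraction.
Variables (G : lgraph R) (X : {set vertex G}).

(* [None] is the new vertex replacing [X]. *)
Definition contr_vertex : finType := option {v | v \notin X}.

Definition contr (v : vertex G) : contr_vertex := insub v.

Definition contract : lgraph R :=
  merge [pred a | ~~ ((gtail a \in X) && (ghead a \in X))]
        (fun a : garc G => ((contr (gtail a), contr (ghead a)), lam a)).

Definition contr_set (Z : {set vertex G}) : {set vertex contract} :=
  [set contr v | v in Z].

(* The arcs of the contraction that correspond to arcs of [A]. *)
Definition contr_arcs (A : {set garc G}) : {set garc contract} :=
  [set b : garc contract | [exists a in A,
     (mu b == (contr (gtail a), contr (ghead a)) :> contr_vertex * contr_vertex)
     && (lam b == lam a)]].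
End Contraction.

Definition contract2 G (X1 X2 : {set vertex G}) : lgraph R :=
  contract (contr_set X1 X2).

Definition contr2_arcs G (X1 X2 : {set vertex G}) (A : {set garc G}) :
    {set garc (contract2 X1 X2)} :=
  contr_arcs (contr_set X1 X2) (contr_arcs X1 A).

Definition synchronising (G1 G2 : lgraph R) (a : garc G1) : bool :=
  [exists b : garc G2, lam b == lam a].

Section Products.
Variables G1 G2 : lgraph R.

Definition pvertex : finType := (vertex G1 * vertex G2)%type.

Definition left_arc (i : garc G1 * vertex G2) : (pvertex * pvertex) * label R :=
  (((gtail i.1, i.2), (ghead i.1, i.2)), lam i.1).

Definition right_arc (i : vertex G1 * garc G2) : (pvertex * pvertex) * label R :=
  (((i.1, gtail i.2), (i.1, ghead i.2)), lam i.2).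

Definition sync_arc (i : garc G1 * garc G2) : (pvertex * pvertex) * label R :=
  (((gtail i.1, gtail i.2), (ghead i.1, ghead i.2)), lam i.1).

Definition cartesian : lgraph R :=
  @merge pvertex (garc G1 * vertex G2 + vertex G1 * garc G2)%type predT
    (fun i => match i with inl j => left_arc j | inr j => right_arc j end).

Definition intermediate : lgraph R :=
  @merge pvertex
    (garc G1 * vertex G2 + vertex G1 * garc G2 + garc G1 * garc G2)%type
    (fun i => match i with
      | inl (inl j) => ~~ synchronising G2 j.1
      | inl (inr j) => ~~ synchronising G1 j.2
      | inr j => lam j.1 == lam j.2
      end)
    (fun i => match i with
      | inl (inl j) => left_arc j
      | inl (inr j) => right_arc j
      | inr j => sync_arc j
      end).

(* The vertices to be removed when the current graph is the subgraph of the
   intermediate product induced by [K]. *)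
Definition vrsp_removable (K : {set vertex intermediate}) : {set vertex intermediate} :=
  [set val v | v : vertex (induced K) &
     (level v == 0) && (0 < @level cartesian (val v))].

(* A removed vertex has in-degree 0 in the current graph, so that removing it
   with the arcs of which it is the tail leaves an induced subgraph.  Every
   round that changes the set removes at least one vertex, so #|pvertex| rounds
   reach the stage where no vertex is removable. *)
Definition vrsp_vertices : {set vertex intermediate} :=
  iter #|pvertex| (fun K => K :\: vrsp_removable K) setT.

Definition vrsp : lgraph R := induced vrsp_vertices.
End Products.

Definition isomorphic G H : Prop :=
  exists2 phi : vertex G -> vertex H, bijective phi &
    forall (u v : vertex G) (l : label R),
      (exists a : garc G, mu a = (u, v) /\ lam a = l) <->
      (exists b : garc H, mu b = (phi u, phi v) /\ lam b = l).

End Graphs.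

(* Main.v *)
Require Import Defs.
From mathcomp Require Import all_boot all_order all_algebra.
From mathcomp Require Import reals.

Set Implicit Arguments.
Unset Strict Implicit.
Unset Printing Implicit Defensive.

(** Every vertex [v] of [G] is sent to the pair of its images in [G/Y] and in
    [G/X1/X2]; this map is injective, and its image consists of the pairs whose
    two coordinates lie in the same one of the three parts [X1], [Y], [X2].

    By the hypothesis on synchronising arcs, an arc of the intermediate product
    comes either from an arc of [G] inside one part, and then it moves one
    coordinate within its part, or from two arcs of [G] with the same label
    pair that both go from one part to another ([has_arc_inter]).  In the second
    case both arcs go from [X1] to [X2] or neither does, because arcs from [X1]
    to [X2] share no label pair with the other ones; since all arcs go forward
    in the order [X1], [Y], [X2], the tails are then in the same part if and
    only if the heads are ([sync_part]).  So no arc of the product enters or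
    leaves the image ([has_arc_embedded]).  Between vertices of the image,
    cleanness merges the two arcs of a synchronising pair into one arc of [G],
    so that the map preserves and reflects arcs ([has_arc_embed]).

    It remains to see that the removal process leaves exactly the image
    ([vrsp_verticesE], [vrsp_embedded]).  A vertex of the image is either the
    image of a source of [G], which lies in [X1] and gives a source of the
    Cartesian product, or it has an incoming arc from the image.  A vertex
    outside the image is never a source of the Cartesian product, because the
    sources of the two quotients come from [X1].  As the intermediate product
    is acyclic, all vertices outside the image are therefore removed, in
    topological order. *)

(** * Arcs of the constructions *)

Section Arcs.
Variable R : realType.
Implicit Type G : lgraph R.

(** There is an arc from [u] to [v] with label pair [l]; this is the relation
    that isomorphisms have to preserve. *)
Definition has_arc G (u v : vertex G) (l : label R) : Prop :=
  exists a : garc G, mu a = (u, v) /\ lam a = l.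

(** The label pair [l] is carried by an arc of [G]. *)
Definition has_label G (l : label R) : Prop := exists a : garc G, lam a = l.

Lemma arcP G (a : garc G) : has_arc (gtail a) (ghead a) (lam a).
Proof. by exists a; split=> //; rewrite [LHS]surjective_pairing. Qed.

Lemma has_arcP G (u v : vertex G) l :
  has_arc u v l <-> exists a : garc G, [/\ gtail a = u, ghead a = v & lam a = l].
Proof.
split=> [[a [ea el]]|[a [<- <- <-]]]; last exact: arcP.
by exists a; rewrite /gtail /ghead ea.
Qed.

Lemma has_arc_label G (u v : vertex G) l : has_arc u v l -> has_label G l.
Proof. by case=> a [_ el]; exists a. Qed.

Lemma synchronisingP (G1 G2 : lgraph R) (a : garc G1) :
  reflect (has_label G2 (lam a)) (synchronising G2 a).
Proof. by apply: (iffP existsP) => -[b eb]; exists b; apply/eqP. Qed.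

Lemma sourcesP G (v : vertex G) :
  reflect (forall u l, ~ has_arc u v l) (v \in sources G).
Proof.
rewrite inE /indeg cards_eq0; apply: (iffP eqP) => [v0 u l|v0].
  by case/has_arcP=> a [_ av _]; have := in_set0 a; rewrite -v0 inE av eqxx.
apply/setP=> a; rewrite !inE; apply/eqP=> av.
by apply: (v0 (gtail a) (lam a)); rewrite -av; exact: arcP.
Qed.

Lemma has_arc_merge (V I : finType) (P : pred I)
    (f : I -> (V * V) * label R) (u v : V) l :
  @has_arc (Defs.merge P f) u v l <-> exists2 i, P i & f i = ((u, v), l).
Proof.
split=> [[b [eb el]]|[i Pi fi]].
  have /imageP[i Pi fi] := valP b; exists i => //.
  by rewrite -fi [LHS]surjective_pairing; congr (_, _).
have fP : f i \in image f P by apply/imageP; exists i.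
by exists (SeqSub fP); rewrite /mu /lam /= fi.
Qed.

Lemma has_arc_induced G (K : {set vertex G}) (u v : {v | v \in K}) l :
  @has_arc (induced K) u v l <-> has_arc (val u) (val v) l.
Proof.
split=> [/has_arcP[a [<- <- <-]]|/has_arcP[a [au av al]]].
  exact: (arcP (val a)).
have aK : (gtail a \in K) && (ghead a \in K).
  by rewrite au av; apply/andP; split; exact: valP.
apply/has_arcP; exists (exist _ a aK); split=> //; exact: val_inj.
Qed.

(** An injection that preserves and reflects arcs is an isomorphism onto the
    subgraph induced by its image. *)
Lemma isomorphic_induced G H (f : vertex G -> vertex H) :
  injective f ->
  (forall u v l, has_arc u v l <-> has_arc (f u) (f v) l) ->
  isomorphic G (induced [set f v | v in setT]).
Proof.
move=> f_inj f_arc; have fK v : f v \in [set f v | v in setT] by exact: imset_f.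
pose phi v : vertex (induced [set f v | v in setT]) := exist _ (f v) (fK v).
have phi_inj : injective phi by move=> u v /(congr1 val); exact: f_inj.
have phi_surj p : exists v, phi v = p.
  have /imsetP[v _ ev] := valP p.
  by exists v; apply: val_inj; rewrite /= -ev.
exists phi.
  by have [psi psiK] := fin_all_exists phi_surj; exists psi => // v; apply: phi_inj.
move=> u v l; split=> [/f_arc uv|uv].
  exact/(has_arc_induced (phi u) (phi v) l).
exact/f_arc/(has_arc_induced (phi u) (phi v) l).
Qed.

Lemma has_arc_contract G (X : {set vertex G}) (p q : contr_vertex X) l :
  @has_arc (contract X) p q l <->
  exists a : garc G, [/\ ~~ ((gtail a \in X) && (ghead a \in X)),
     contr X (gtail a) = p, contr X (ghead a) = q & lam a = l].
Proof.
rewrite has_arc_merge; split=> [[a aX [<- <- <-]]|[a [aX <- <- <-]]].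
  by exists a.
by exists a.
Qed.

Lemma contr_arcsP G (X : {set vertex G}) (A : {set garc G})
    (b : garc (contract X)) :
  reflect (exists2 a, a \in A &
     [/\ gtail b = contr X (gtail a), ghead b = contr X (ghead a)
        & lam b = lam a])
    (b \in contr_arcs X A).
Proof.
rewrite inE; apply: (iffP exists_inP) => -[a aA].
  by case/andP=> /eqP eb /eqP el; exists a => //; rewrite /gtail /ghead eb.
case=> et eh el; exists a => //; rewrite el eqxx andbT; apply/eqP.
by rewrite -et -eh [LHS]surjective_pairing.
Qed.

Lemma contr_eq G (X : {set vertex G}) (u v : vertex G) :
  contr X u = contr X v <-> u = v \/ (u \in X) && (v \in X).
Proof.
rewrite /contr; split=> [|[-> //|/andP[uX vX]]].
  case: insubP => [u' _ <-|]; case: insubP => [v' _ <-|] //.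
    by case=> ->; left.
  by rewrite !negbK => -> ->; right.
by rewrite !insubN ?uX ?vX.
Qed.

Lemma contr_surj G (X : {set vertex G}) (p : contr_vertex X) :
  X != set0 -> exists v, contr X v = p.
Proof.
case/set0Pn=> x xX; case: p => [v|]; last by exists x; rewrite /contr insubN ?xX.
by exists (val v); rewrite /contr valK.
Qed.

Lemma mem_contr_set G (X Z : {set vertex G}) v :
  [disjoint X & Z] -> (contr X v \in contr_set X Z) = (v \in Z).
Proof.
move=> XZ; apply/imsetP/idP=> [[z zZ /contr_eq[->|/andP[_ zX]]]|vZ] //.
  by have := disjointFr XZ zX; rewrite zZ.
by exists v.
Qed.

(** * Sources and levels *)

Lemma level_eq0 G (v : vertex G) : (level v == 0) = (v \in sources G).
Proof.
rewrite /level; have -> : #|vertex G| = #|vertex G|.-1.+1.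
  by rewrite prednK //; apply/card_gt0P; exists v.
have <- : (v \in level_set G 0) = (v \in sources G).
  apply/imsetP/sourcesP=> [[v' /sourcesP v0 ->] u l ul|v0].
    by apply: (v0 (exist _ u (in_setT u)) l); apply/has_arc_induced.
  exists (exist _ v (in_setT v)) => //; apply/sourcesP => u l.
  by move/has_arc_induced; exact: v0.
by rewrite [iota _ _]/= [find _ _]/=; case: (v \in level_set G 0).
Qed.

End Arcs.

(** * The vertex-removing synchronised product *)

Section Vrsp.
Variables (R : realType) (G1 G2 : lgraph R).
Local Notation inter := (intermediate G1 G2).
Implicit Types (p q : vertex inter) (K I : {set vertex inter}).

Lemma cartesian_source p :
  (p \in sources (cartesian G1 G2)) =
  (p.1 \in sources G1) && (p.2 \in sources G2).
Proof.
case: p => p1 p2 /=; apply/(@sourcesP _ (cartesian G1 G2))/andP.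
  move=> p0; split; apply/sourcesP=> u l /has_arcP[a [au ap al]].
    apply: (p0 (u, p2) l); apply/has_arc_merge.
    by exists (inl (a, p2)) => //; rewrite /Defs.left_arc /= au ap al.
  apply: (p0 (p1, u) l); apply/has_arc_merge.
  by exists (inr (p1, a)) => //; rewrite /Defs.right_arc /= au ap al.
case=> /sourcesP s1 /sourcesP s2 u l.
case/has_arc_merge=> -[[a p']|[p' a]] _ [_ ea eb _].
  by apply: (s1 (gtail a) (lam a)); rewrite -ea; exact: arcP.
by apply: (s2 (gtail a) (lam a)); rewrite -eb; exact: arcP.
Qed.

Lemma has_arc_intermediate p q l :
  has_arc p q l <->
  [\/ [/\ has_arc p.1 q.1 l, p.2 = q.2 & ~ has_label G2 l],
      [/\ p.1 = q.1, has_arc p.2 q.2 l & ~ has_label G1 l]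
    | has_arc p.1 q.1 l /\ has_arc p.2 q.2 l].
Proof.
case: p q => p1 p2 [q1 q2]; rewrite [p1]lock [p2]lock /= -!lock.
rewrite has_arc_merge; split.
  case=> -[[[a w]|[w a]]|[a b]] /=.
  - move=> aN [<- <- <- <- <-]; apply: Or31; split=> //; first exact: arcP.
    by move/synchronisingP: aN.
  - move=> aN [<- <- <- <- <-]; apply: Or32; split=> //; first exact: arcP.
    by move/synchronisingP: aN.
  - move/eqP=> eab [<- <- <- <- <-]; apply: Or33; split; first exact: arcP.
    rewrite eab; exact: arcP.
case=> [[/has_arcP[a [ap aq al]] -> lN]|[-> /has_arcP[a [ap aq al]] lN]|].
- exists (inl (inl (a, q2))); last by rewrite /Defs.left_arc /= ap aq al.
  by apply/synchronisingP; rewrite al.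
- exists (inl (inr (q1, a))); last by rewrite /Defs.right_arc /= ap aq al.
  by apply/synchronisingP; rewrite al.
case=> /has_arcP[a [ap aq al]] /has_arcP[b [bp bq bl]].
by exists (inr (a, b)); rewrite /sync_arc /= ?al ?bl ?ap ?aq ?bp ?bq.
Qed.

Lemma vrsp_removableP K p :
  reflect [/\ p \in K, forall q l, q \in K -> ~ has_arc q p l
            & p \notin sources (cartesian G1 G2)]
    (p \in vrsp_removable K).
Proof.
apply: (iffP imsetP) => [[v]|[pK p0 pN]].
  rewrite inE lt0n !level_eq0 => /andP[/sourcesP v0 vN] ->; split=> //.
    exact: valP.
  move=> q l qK qv; apply: (v0 (exist _ q qK) l); exact/has_arc_induced.
exists (exist _ p pK) => //; rewrite inE lt0n !level_eq0 pN andbT.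
by apply/sourcesP=> u l /has_arc_induced; apply: p0; exact: valP.
Qed.

Local Notation stage n :=
  (iter n (fun K => K :\: vrsp_removable K) [set: vertex inter]).

(** A set [I] of vertices is what the removal leaves as soon as no arc enters
    or leaves it, each of its vertices is a source of the Cartesian product or
    has an incoming arc, and no other vertex is such a source.  The vertices
    outside [I] disappear in the order of any function that increases along
    the arcs. *)
Lemma vrsp_verticesE I (r : vertex inter -> nat) :
  (forall p q l, has_arc p q l -> r p < r q) ->
  (forall p q l, has_arc p q l -> (p \in I) = (q \in I)) ->
  (forall p, p \in I ->
     p \in sources (cartesian G1 G2) \/ exists q l, has_arc q p l) ->
  (forall p, p \notin I -> p \notin sources (cartesian G1 G2)) ->
  vrsp_vertices G1 G2 = I.
Proof.
move=> r_lt clI inI outI.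
have kept n : I \subset stage n.
  elim: n => [|n IHn]; first exact: subsetT.
  rewrite subsetD IHn disjoint_sym disjoints_subset /=.
  apply/subsetP=> p /vrsp_removableP[_ p0 pN]; rewrite inE; apply/negP=> pI.
  case: (inI p pI) => [|[q [l qp]]]; first by rewrite (negPf pN).
  by case: (p0 q l) => //; apply: (subsetP IHn); rewrite (clI _ _ _ qp).
(* The number of vertices of smaller rank bounds the number of rounds after
   which a vertex outside [I] is gone. *)
pose h p := #|[set q | r q < r p]|.
have h_lt p q : r p < r q -> h p < h q.
  move=> pq; apply: proper_card; apply/properP; split.
    by apply/subsetP=> z; rewrite !inE => /ltn_trans->.
  by exists p; rewrite inE ?ltnn.
have gone n p : p \notin I -> h p < n -> p \notin stage n.
  elim: n p => // n IHn p pI hp; rewrite /= inE negb_and negbK.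
  have [pK|pK] := boolP (p \in stage n); apply/orP; [left|by right].
  apply/vrsp_removableP; split=> //; last exact: outI.
  move=> q l qK qp.
  have hq : h q < n := leq_trans (h_lt _ _ (r_lt _ _ _ qp)) hp.
  by move: qK; apply/negP/IHn => //; rewrite (clI _ _ _ qp).
apply/eqP; rewrite eqEsubset kept andbT; apply/subsetP=> p pK.
apply/negPn/negP=> pI; move: pK; apply/negP; apply: gone => //.
rewrite -cardsT; apply: proper_card; apply/properP; split; first exact: subsetT.
by exists p; rewrite !inE ?ltnn.
Qed.

End Vrsp.

(** * Acyclic graphs and clean bipartite subgraphs *)

Section Structure.
Variables (R : realType) (G : lgraph R).

(** The number of vertices from which [v] can be reached; in an acyclic graph
    it increases along the arcs. *)
Definition rank (v : vertex G) : nat := #|[set w | connect (@adj R G) w v]|.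

Lemma rank_lt u v l : acyclic G -> has_arc u v l -> rank u < rank v.
Proof.
move=> acG [a [ea _]]; have uv : adj u v by apply/existsP; exists a; apply/eqP.
apply: proper_card; apply/properP; split.
  by apply/subsetP=> w; rewrite !inE => /connect_trans; apply; exact: connect1.
exists v; rewrite inE ?connect0 //; apply/negP=> /connectP[s vs eu].
have /negP[] := acG (v :: s) isT.
by rewrite /= rcons_path vs -eu uv.
Qed.

(** A vertex of minimal rank in [Z] has an incoming arc, which cannot have its
    tail in [Z]. *)
Lemma entering_arc (Z : {set vertex G}) :
  acyclic G -> Z != set0 -> (forall z, z \in Z -> z \notin sources G) ->
  exists2 a : garc G, ghead a \in Z & gtail a \notin Z.
Proof.
move=> acG /set0Pn[z0 z0Z] nosrc.
case: (arg_minnP rank z0Z) => z zZ zmin; have := nosrc z zZ.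
rewrite inE /indeg -lt0n => /card_gt0P[a]; rewrite inE => /eqP az.
exists a; first by rewrite az.
apply/negP=> /zmin; rewrite leqNgt -az.
by rewrite (rank_lt acG (arcP a)).
Qed.

(** In a clean bipartite subgraph, two arcs with the same label pair span a
    third one, from the tail of the first to the head of the second. *)
Lemma clean_between_arc (X Y : {set vertex G}) (a b : garc G) :
  [disjoint X & Y] -> clean_between X Y -> no_backward X Y ->
  a \in between X Y -> b \in between X Y -> lam a = lam b ->
  has_arc (gtail a) (ghead b) (lam a).
Proof.
move=> XY [_ cl _] nb aXY bXY eab.
have [aY bY] := (nb a aXY, nb b bXY).
have aX : gtail a \in X.
  by move: aXY; rewrite inE (disjointFl XY aY) andbF orbF => /andP[].
set H := arc_induced (between X Y) in cl.
pose a' : garc H := exist _ a aXY; pose b' : garc H := exist _ b bXY.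
have [V1 [V2 [[[_ _ V12 _ _] cp] V1X V2Y]]] := cl a'.
set L := arc_induced _ in V1 V2 V12 cp V1X V2Y.
have aL : a' \in label_arcs H (lam a') by rewrite inE.
have bL : b' \in label_arcs H (lam a') by rewrite inE; apply/eqP; exact: esym eab.
pose a2 : garc L := exist _ a' aL; pose b2 : garc L := exist _ b' bL.
have a2V : gtail a2 \in V1.
  have := in_setT (gtail a2); rewrite -V12 inE => /orP[//|a2V].
  have := subsetP V2Y _ (imset_f val a2V); rewrite inE /= => aY'.
  by have := disjointFr XY aX; rewrite aY'.
have b2V : ghead b2 \in V2.
  have := in_setT (ghead b2); rewrite -V12 inE => /orP[b2V|//].
  have := subsetP V1X _ (imset_f val b2V); rewrite inE /= => bX'.
  by have := disjointFr XY bX'; rewrite bY.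
have [c ec] := cp _ _ a2V b2V.
have cXY : val (val c) \in between X Y := valP (val c).
have lc : lam (val (val c)) = lam a.
  by have := valP c; rewrite inE => /eqP.
apply/has_arcP; exists (val (val c)); case: ec => ec.
  split=> //; first exact: (congr1 (fun p => val (val p.1)) ec).
  exact: (congr1 (fun p => val (val p.2)) ec).
have := nb _ cXY; have -> : ghead (val (val c)) = gtail a.
  exact: (congr1 (fun p => val (val p.2)) ec).
by rewrite (disjointFr XY aX).
Qed.

End Structure.

(** * Splitting a graph into three parts *)

Section Decomposition.
Variables (R : realType) (G : lgraph R) (X1 X2 Y : {set vertex G}).
Hypothesis acycG : acyclic G.
Hypothesis defY : Y = ~: (X1 :|: X2).
Hypothesis disjX : [disjoint X1 & X2].
Hypotheses (X1n0 : X1 != set0) (X2n0 : X2 != set0) (Yn0 : Y != set0).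
Hypotheses (clean1 : clean_between X1 Y) (clean2 : clean_between Y X2).
Hypothesis lab12 : forall a b : garc G, a \in between X1 X2 ->
  b \in between X1 Y :|: between Y X2 -> lam a <> lam b.
Let A := between X1 Y :|: between Y X2 :|: between X1 X2.
Hypothesis sync2 : forall b : garc (contract2 X1 X2),
  synchronising (contract Y) b <-> b \in contr2_arcs X1 X2 A.
Hypothesis sync1 : forall b : garc (contract Y),
  synchronising (contract2 X1 X2) b <-> b \in contr_arcs Y A.
Hypothesis srcX1 : sources G \subset X1.
Hypotheses (nb1 : no_backward X1 Y) (nb2 : no_backward Y X2).
Hypothesis nb12 : no_backward X1 X2.

Local Notation G1 := (contract Y).
Local Notation G2 := (contract2 X1 X2).
Local Notation inter := (intermediate G1 G2).

(** The part of a vertex, numbered in the direction of the arcs: 0 for [X1],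
    1 for [Y] and 2 for [X2]. *)
Definition part (v : vertex G) : nat :=
  if v \in X1 then 0 else if v \in Y then 1 else 2.

(** The arc goes from one part to another. *)
Definition crossing (a : garc G) : bool := part (gtail a) != part (ghead a).

(** The two quotient maps, and the embedding of [G] in the product. *)
Definition quot1 (v : vertex G) : vertex G1 := contr Y v.
Definition quot2 (v : vertex G) : vertex G2 :=
  contr (contr_set X1 X2) (contr X1 v).
Definition embed (v : vertex G) : vertex inter := (quot1 v, quot2 v).

Lemma mem_X1 v : (v \in X1) = (part v == 0).
Proof. by rewrite /part; case: ifP => // _; case: ifP. Qed.

Lemma mem_X2 v : (v \in X2) = (part v == 2).
Proof.
rewrite /part; case: ifP => [/(disjointFr disjX)->//|v1].
by rewrite defY !inE v1; case: (v \in X2).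
Qed.

Lemma mem_Y v : (v \in Y) = (part v == 1).
Proof. by rewrite defY !inE mem_X1 mem_X2 /part; do !case: ifP. Qed.

Lemma part_le v : part v <= 2.
Proof. by rewrite /part; do !case: ifP. Qed.

Lemma mem_cross a : (a \in A) = crossing a.
Proof.
rewrite !inE !(mem_X1, mem_X2, mem_Y) /crossing.
by rewrite /part; do !case: ifP.
Qed.

Lemma part_arc a : part (gtail a) <= part (ghead a).
Proof.
have := nb1 (a := a); have := nb2 (a := a); have := nb12 (a := a).
rewrite !inE !(mem_X1, mem_X2, mem_Y).
move: (part_le (gtail a)) (part_le (ghead a)).
case: (part (gtail a)) (part (ghead a)) => [|[|[|?]]] [|[|[|?]]] //= _ _.
all: move=> h12 h2 h1.
all: by [have := h1 isT | have := h2 isT | have := h12 isT].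
Qed.

Lemma quot1_eq u v :
  quot1 u = quot1 v <-> u = v \/ (part u == 1) && (part v == 1).
Proof. by rewrite contr_eq !mem_Y. Qed.

Lemma quot2_eq u v :
  quot2 u = quot2 v <-> u = v \/ (part u == part v) && (part u != 1).
Proof.
rewrite contr_eq !mem_contr_set // contr_eq !mem_X1 !mem_X2.
move: (part_le u) (part_le v).
by case: (part u) (part v) => [|[|[|?]]] [|[|[|?]]] //= _ _; intuition.
Qed.

Lemma quot1_part u v : quot1 u = quot1 v -> part u = part v.
Proof. by case/quot1_eq=> [->//|/andP[/eqP-> /eqP->]]. Qed.

Lemma quot2_part u v : quot2 u = quot2 v -> part u = part v.
Proof. by case/quot2_eq=> [->//|/andP[/eqP->]]. Qed.

Lemma quot1_surj (p : vertex G1) : exists v, quot1 v = p.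
Proof. exact: contr_surj. Qed.

Lemma quot2_surj (p : vertex G2) : exists v, quot2 v = p.
Proof.
have [|w ew] := contr_surj p.
  case/set0Pn: X2n0 => x xX2; apply/set0Pn; exists (contr X1 x).
  by rewrite mem_contr_set.
by have [v ev] := contr_surj w X1n0; exists v; rewrite /quot2 ev.
Qed.

Lemma embed_inj : injective embed.
Proof.
move=> u v [/quot1_eq[//|/andP[/eqP u1 _]] /quot2_eq[//|]].
by rewrite u1 eqxx andbF.
Qed.

(** An arc of [G] survives in a quotient if it is crossing or lies inside a part
    that is not contracted; those are all the arcs of the quotient. *)
Lemma has_arc1 (p q : vertex G1) l :
  has_arc p q l <->
  exists a, [/\ crossing a || (part (gtail a) != 1), quot1 (gtail a) = p,
                quot1 (ghead a) = q & lam a = l].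
Proof.
have E a : crossing a || (part (gtail a) != 1) =
    ~~ ((gtail a \in Y) && (ghead a \in Y)).
  by rewrite !mem_Y /crossing /part; do !case: ifP.
by rewrite has_arc_contract; split=> -[a [aN <- <- <-]]; exists a;
  split=> //; rewrite E in aN *.
Qed.

Lemma has_arc2 (p q : vertex G2) l :
  has_arc p q l <->
  exists a, [/\ crossing a || (part (gtail a) == 1), quot2 (gtail a) = p,
                quot2 (ghead a) = q & lam a = l].
Proof.
have E a : crossing a || (part (gtail a) == 1) =
    ~~ ((gtail a \in X1) && (ghead a \in X1)) &&
    ~~ ((gtail a \in X2) && (ghead a \in X2)).
  by rewrite !mem_X1 !mem_X2 /crossing /part; do !case: ifP.
rewrite has_arc_contract; split=> [[b [bN <- <- <-]]|[a [aN <- <- <-]]].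
  have /has_arc_contract[a [aN at_ ah al]] := arcP b.
  exists a; split; rewrite /quot2 ?at_ ?ah //.
  by rewrite E aN -!(mem_contr_set _ disjX) at_ ah.
rewrite E in aN; case/andP: aN => aN1 aN2.
have /has_arcP[b [bt bh bl]] : @has_arc R (contract X1)
    (contr X1 (gtail a)) (contr X1 (ghead a)) (lam a).
  by apply/has_arc_contract; exists a.
by exists b; rewrite /quot2 bt bh bl !mem_contr_set.
Qed.

(** Among the arcs of [G] that survive in a quotient, the crossing ones are
    those whose label pair also occurs in the other quotient. *)
Lemma sync_crossing1 a :
  crossing a || (part (gtail a) != 1) -> has_label G2 (lam a) <-> crossing a.
Proof.
move=> aN; have /has_arcP[b [bt bh bl]] :
  @has_arc R G1 (quot1 (gtail a)) (quot1 (ghead a)) (lam a).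
  by apply/has_arc1; exists a.
rewrite -bl; split=> [/synchronisingP/sync1/contr_arcsP[c]|ca].
  rewrite mem_cross bt bh => cc [/quot1_part et /quot1_part eh _].
  by rewrite /crossing et eh.
by apply/synchronisingP/sync1/contr_arcsP; exists a; rewrite ?mem_cross.
Qed.

Lemma sync_crossing2 a :
  crossing a || (part (gtail a) == 1) -> has_label G1 (lam a) <-> crossing a.
Proof.
move=> aN; have /has_arcP[b [bt bh bl]] :
  @has_arc R G2 (quot2 (gtail a)) (quot2 (ghead a)) (lam a).
  by apply/has_arc2; exists a.
rewrite -bl; split=> [/synchronisingP/sync2/contr_arcsP[c]|ca].
  case/contr_arcsP=> d; rewrite mem_cross bt bh => cd [ct ch _].
  rewrite ct ch => -[/quot2_part et /quot2_part eh _].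
  by rewrite /crossing et eh.
have /has_arcP[c [ct ch cl]] : @has_arc R (contract X1)
    (contr X1 (gtail a)) (contr X1 (ghead a)) (lam a).
  apply/has_arc_contract; exists a; split=> //.
  by move: ca; rewrite !mem_X1 /crossing; apply: contra => /andP[/eqP-> /eqP->].
apply/synchronisingP/sync2/contr_arcsP; exists c; last by rewrite ct ch cl.
by apply/contr_arcsP; exists a; rewrite ?mem_cross.
Qed.

Lemma crossing_lt a : crossing a -> part (gtail a) < part (ghead a).
Proof. by rewrite ltn_neqAle part_arc andbT. Qed.

(** The arcs from [X1] to [X2] are the only ones that skip a part, so two
    crossing arcs with the same label pair either both skip it, or neither. *)
Lemma sync_part a b : crossing a -> crossing b -> lam a = lam b ->
  (part (gtail a) == part (gtail b)) = (part (ghead a) == part (ghead b)).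
Proof.
have sk c d : crossing c -> crossing d -> lam c = lam d ->
    c \in between X1 X2 -> d \in between X1 X2.
  rewrite -!mem_cross => _ dA ecd c12; move: dA; rewrite inE => /orP[d12|//].
  by have := lab12 c12 d12 ecd.
move=> ca cb eab; have := sk a b ca cb eab; have := sk b a cb ca (esym eab).
move: (crossing_lt ca) (crossing_lt cb) (part_le (ghead a)) (part_le (ghead b)).
rewrite !inE !mem_X1 !mem_X2.
case: (part (gtail a)) (part (ghead a)) => [|[|[|?]]] [|[|[|?]]] //=.
all: case: (part (gtail b)) (part (ghead b)) => [|[|[|?]]] [|[|[|?]]] //=.
all: move=> _ _ _ _ h1 h2.
all: by [have := h1 isT | have := h2 isT].
Qed.

(** An arc of the intermediate product comes from one arc inside [X1] or
    [X2], from one arc inside [Y], or from two crossing arcs. *)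
Lemma has_arc_inter (p q : vertex inter) l :
  has_arc p q l <->
  [\/ exists a, [/\ ~~ crossing a && (part (gtail a) != 1),
        quot1 (gtail a) = p.1, quot1 (ghead a) = q.1, lam a = l & p.2 = q.2],
      exists a, [/\ ~~ crossing a && (part (gtail a) == 1),
        quot2 (gtail a) = p.2, quot2 (ghead a) = q.2, lam a = l & p.1 = q.1]
    | exists a b, [/\ crossing a && crossing b, lam a = l, lam b = l,
        quot1 (gtail a) = p.1 /\ quot1 (ghead a) = q.1
      & quot2 (gtail b) = p.2 /\ quot2 (ghead b) = q.2]].
Proof.
rewrite has_arc_intermediate; split.
  case=> [[/has_arc1[a [aN at_ ah al]] pq lN]
         |[pq /has_arc2[a [aN at_ ah al]] lN]|].
  - apply: Or31; exists a; split=> //; have := sync_crossing1 aN.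
    by rewrite al; case: (crossing a) aN => //= _ [_] /(_ isT).
  - apply: Or32; exists a; split=> //; have := sync_crossing2 aN.
    by rewrite al; case: (crossing a) aN => //= _ [_] /(_ isT).
  case=> la lb; move: (la) (lb).
  case/has_arc1=> a [aN at_ ah al] /has_arc2[b [bN bt bh bl]].
  apply: Or33; exists a, b; split=> //; apply/andP; split.
    by apply/(sync_crossing1 aN); rewrite al; exact: has_arc_label lb.
  by apply/(sync_crossing2 bN); rewrite bl; exact: has_arc_label la.
case=> [[a [/andP[aN a1] at_ ah al pq]]|[a [/andP[aN a1] at_ ah al pq]]|].
- apply: Or31; split=> //; first by apply/has_arc1; exists a; rewrite a1 orbT.
  by rewrite -al => /sync_crossing1; rewrite a1 orbT (negPf aN) => /(_ isT).
- apply: Or32; split=> //; first by apply/has_arc2; exists a; rewrite a1 orbT.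
  by rewrite -al => /sync_crossing2; rewrite a1 orbT (negPf aN) => /(_ isT).
case=> a [b [/andP[ca cb] al bl [at_ ah] [bt bh]]]; apply: Or33; split.
  by apply/has_arc1; exists a; rewrite ca.
by apply/has_arc2; exists b; rewrite cb.
Qed.

(** The embedding preserves and reflects arcs.  Cleanness is needed when two
    different arcs of [G] synchronise: an arc of [G] with the tail of one, the
    head of the other and their label pair must exist. *)
Lemma has_arc_embed u v l : has_arc u v l <-> has_arc (embed u) (embed v) l.
Proof.
rewrite has_arc_inter /embed /=; split.
  case/has_arcP=> a [<- <- <-]; case: (boolP (crossing a)) => ca.
    by apply: Or33; exists a, a; rewrite ca.
  have /eqP ea : part (gtail a) == part (ghead a) by rewrite -[_ == _]negbK.
  case: (eqVneq (part (gtail a)) 1) => a1.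
    apply: Or32; exists a; rewrite ca a1; split=> //; apply/quot1_eq; right.
    by rewrite -ea a1.
  apply: Or31; exists a; rewrite ca a1; split=> //; apply/quot2_eq; right.
  by rewrite -ea eqxx a1.
case=> [[a [/andP[aN a1] at_ ah al uv]]|[a [/andP[aN a1] at_ ah al uv]]|].
- rewrite negbK in aN; have [eu ev] := (quot1_part at_, quot1_part ah).
  move/quot1_eq: at_; rewrite (negPf a1) => -[<-|//].
  move/quot1_eq: ah; rewrite -(eqP aN) (negPf a1) => -[<-|//].
  by rewrite -al; exact: arcP.
- rewrite negbK in aN; have [eu ev] := (quot2_part at_, quot2_part ah).
  move/quot2_eq: at_; rewrite a1 andbF => -[<-|//].
  move/quot2_eq: ah; rewrite -(eqP aN) a1 andbF => -[<-|//].
  by rewrite -al; exact: arcP.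
case=> a [b [/andP[ca cb] al bl [at_ ah] [bt bh]]].
have [pta pha] := (quot1_part at_, quot1_part ah).
have [ptb phb] := (quot2_part bt, quot2_part bh).
have [uv v2] := (crossing_lt ca, part_le v); rewrite pta pha in uv.
have between_part (X Z : {set vertex G}) i j :
    (forall w, (w \in X) = (part w == i)) ->
    (forall w, (w \in Z) = (part w == j)) -> part u = i -> part v = j ->
    a \in between X Z /\ b \in between X Z.
  by move=> Xi Zj ui vj; rewrite !inE !Xi !Zj pta pha ptb phb ui vj !eqxx.
have disj_part (X Z : {set vertex G}) i j :
    (forall w, (w \in X) = (part w == i)) ->
    (forall w, (w \in Z) = (part w == j)) -> i != j -> [disjoint X & Z].
  move=> Xi Zj ij; rewrite disjoint_subset; apply/subsetP=> w.
  by rewrite inE Xi Zj => /eqP->.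
have eab : lam a = lam b by rewrite al.
(* [quot1] determines the ends outside [Y], and [quot2] the end in [Y]; so [u]
   and [v] are ends of the same arc if no end is in [Y], and otherwise each of
   [a] and [b] provides one of them. *)
move/quot1_eq: at_; move/quot1_eq: ah; move/quot2_eq: bt; move/quot2_eq: bh.
rewrite pta pha ptb phb !andbb !eqxx /=.
case pu: (part u) uv => [|[|i]] uv.
- case pv: (part v) uv => [|[|j]] // _ /=.
    case=> // <- _ _ [] // <-; rewrite -al.
    have [aXY bXY] := between_part X1 Y 0 1 mem_X1 mem_Y pu pv.
    exact: clean_between_arc (disj_part _ _ _ _ mem_X1 mem_Y isT) _ _ _ _ _.
  by move=> _ _ [] // <- [] // <-; rewrite -al; exact: arcP.
- have pv : part v = 2 by apply/eqP; rewrite eqn_leq v2.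
  rewrite pv /= => _ [] // <- [] // <- _; rewrite -bl.
  have [aXY bXY] := between_part Y X2 1 2 mem_Y mem_X2 pu pv.
  exact: clean_between_arc (disj_part _ _ _ _ mem_Y mem_X2 isT) _ _ _ _ _.
- by have := leq_trans uv v2.
Qed.

(** The image of [G] in the product. *)
Definition embedded : {set vertex inter} := [set embed v | v in setT].

Lemma mem_embedded u w :
  ((quot1 u, quot2 w) \in embedded) = (part u == part w).
Proof.
apply/imsetP/eqP=> [[v _ [/quot1_part-> /quot2_part->]]|uw] //.
have [u1|u1] := eqVneq (part u) 1; last first.
  exists u => //; congr (_, _); apply/quot2_eq.
  by right; rewrite uw eqxx -uw u1.
by exists w => //; congr (_, _); apply/quot1_eq; right; rewrite -uw u1.
Qed.

Lemma has_arc_embedded (p q : vertex inter) l :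
  has_arc p q l -> (p \in embedded) = (q \in embedded).
Proof.
case: p q => p1 p2 [q1 q2] /has_arc_inter /=.
case=> [[a [/andP[/negPn/eqP aN _] <- <- _ <-]]
       |[a [/andP[/negPn/eqP aN _] <- <- _ <-]]|].
- by have [w <-] := quot2_surj p2; rewrite !mem_embedded aN.
- by have [w <-] := quot1_surj p1; rewrite !mem_embedded aN.
case=> a [b [/andP[ca cb] al bl [<- <-] [<- <-]]]; rewrite !mem_embedded.
by apply: sync_part; rewrite // al.
Qed.

Lemma source_part v : part v != 0 -> v \notin sources G.
Proof. by rewrite -mem_X1; apply: contra; exact: (subsetP srcX1). Qed.

(** A part other than [X1] contains no source, so it is entered by an arc; the
    same holds for a single vertex outside [X1].  Hence a source of a quotient
    comes from [X1]. *)
Lemma quot1_source v : quot1 v \in sources G1 -> part v = 0.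
Proof.
move=> /sourcesP src; apply/eqP/negPn/negP=> v0.
have [|w|a] := @entering_arc _ G [set w | quot1 w == quot1 v] acycG.
- by apply/set0Pn; exists v; rewrite inE.
- by rewrite inE => /eqP/quot1_part ew; apply: source_part; rewrite ew.
rewrite !inE => /eqP ah at_; apply: (src (quot1 (gtail a)) (lam a)).
apply/has_arc1; exists a; split=> //; apply: contraNT at_.
rewrite negb_or !negbK -ah => /andP[/eqP e a1]; apply/eqP/quot1_eq; right.
by rewrite -e a1.
Qed.

Lemma quot2_source v : quot2 v \in sources G2 -> part v = 0.
Proof.
move=> /sourcesP src; apply/eqP/negPn/negP=> v0.
have [|w|a] := @entering_arc _ G [set w | quot2 w == quot2 v] acycG.
- by apply/set0Pn; exists v; rewrite inE.
- by rewrite inE => /eqP/quot2_part ew; apply: source_part; rewrite ew.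
rewrite !inE => /eqP ah at_; apply: (src (quot2 (gtail a)) (lam a)).
apply/has_arc2; exists a; split=> //; apply: contraNT at_.
rewrite negb_or negbK -ah => /andP[/eqP e a1]; apply/eqP/quot2_eq; right.
by rewrite e eqxx -e a1.
Qed.

Lemma embed_source v :
  v \in sources G -> embed v \in sources (cartesian G1 G2).
Proof.
move=> vs; rewrite cartesian_source; have := subsetP srcX1 _ vs.
rewrite mem_X1 => /eqP v0; apply/andP; split; apply/sourcesP=> u l.
  case/has_arc1=> a [_ _ /quot1_eq[ea|/andP[_ /eqP v1]] _].
    move/sourcesP: vs => /(_ (gtail a) (lam a)); apply.
    by rewrite -ea; exact: arcP.
  by rewrite v0 in v1.
case/has_arc2=> a [aN _ /quot2_part ea _]; move: aN (part_arc a).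
by rewrite /crossing ea v0 leqn0; case: (part _).
Qed.

(** The position in a topological order of a quotient: first by the part, then
    by the rank inside the parts that are not contracted; [c] selects the
    contracted parts. *)
Definition height (c : pred nat) (v : vertex G) : nat :=
  part v * #|vertex G|.+1 + (if c (part v) then 0 else rank v).

Lemma height_lt (c : pred nat) a : crossing a || ~~ c (part (gtail a)) ->
  height c (gtail a) < height c (ghead a).
Proof.
rewrite /height; case: (boolP (crossing a)) => [/crossing_lt ca _|].
  apply: leq_trans (leq_addr _ _).
  apply: leq_trans (leq_mul ca (leqnn _)); rewrite mulSn addnC ltn_add2r.
  by case: ifP => // _; rewrite ltnS max_card.
rewrite negbK => /eqP <- /= /negPf ->; rewrite ltn_add2l.
exact: rank_lt (arcP a).
Qed.

(** Both quotients are acyclic: some function increases along their arcs. *)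
Lemma rank1 : exists r : vertex G1 -> nat,
  forall p q l, has_arc p q l -> r p < r q.
Proof.
have [s sK] := fin_all_exists quot1_surj.
pose c := pred1 1; exists (height c \o s).
move=> p q l /has_arc1[a [aN <- <- _]] /=.
have hE v : height c (s (quot1 v)) = height c v.
  by case/quot1_eq: (sK (quot1 v)) => [->//|]; rewrite /height /c /= =>
    /andP[/eqP-> /eqP->].
by rewrite !hE height_lt.
Qed.

Lemma rank2 : exists r : vertex G2 -> nat,
  forall p q l, has_arc p q l -> r p < r q.
Proof.
have [s sK] := fin_all_exists quot2_surj.
pose c := predC1 1; exists (height c \o s).
move=> p q l /has_arc2[a [aN <- <- _]] /=.
have hE v : height c (s (quot2 v)) = height c v.
  by case/quot2_eq: (sK (quot2 v)) => [->//|]; rewrite /height /c /= =>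
    /andP[/eqP-> ->].
by rewrite !hE height_lt //= negbK.
Qed.

Lemma vrsp_embedded : vrsp_vertices G1 G2 = embedded.
Proof.
have [r1 r1_lt] := rank1; have [r2 r2_lt] := rank2.
apply: (@vrsp_verticesE _ _ _ _ (fun p => r1 p.1 + r2 p.2)).
- move=> p q l /has_arc_intermediate.
  case=> [[/r1_lt pq -> _]|[-> /r2_lt pq _]|[/r1_lt pq1 /r2_lt pq2]].
  + by rewrite ltn_add2r.
  + by rewrite ltn_add2l.
  + by rewrite -addSn leq_add // ltnW.
- exact: has_arc_embedded.
- move=> p /imsetP[v _ ->]; have [vs|] := boolP (v \in sources G).
    by left; exact: embed_source.
  rewrite inE /indeg -lt0n => /card_gt0P[a]; rewrite inE => /eqP <-; right.
  by exists (embed (gtail a)), (lam a); apply/has_arc_embed; exact: arcP.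
- case=> p1 p2; have [u <-] := quot1_surj p1; have [w <-] := quot2_surj p2.
  rewrite mem_embedded cartesian_source => uw; apply/negP=> /andP[].
  by move=> /quot1_source u0 /quot2_source w0; rewrite u0 w0 in uw.
Qed.

Lemma isomorphic_vrsp : isomorphic G (vrsp G1 G2).
Proof.
rewrite /vrsp vrsp_embedded.
exact: isomorphic_induced embed_inj has_arc_embed.
Qed.

End Decomposition.

Theorem theorem6p2 (R : realType) (G : lgraph R) (X1 X2 Y : {set vertex G})
  (acycG : acyclic G)
  (connG : weakly_connected G)
  (defY : Y = ~: (X1 :|: X2))
  (disjX : [disjoint X1 & X2])
  (X1n0 : X1 != set0) (X2n0 : X2 != set0) (Yn0 : Y != set0)
  (clean1 : clean_between X1 Y)
  (clean2 : clean_between Y X2)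
  (lab12 : forall a b : garc G, a \in between X1 X2 ->
     b \in between X1 Y :|: between Y X2 -> lam a <> lam b)
  (sync12 : let A := between X1 Y :|: between Y X2 :|: between X1 X2 in
     (forall b : garc (contract2 X1 X2),
        synchronising (contract Y) b <-> b \in contr2_arcs X1 X2 A) /\
     (forall b : garc (contract Y),
        synchronising (contract2 X1 X2) b <-> b \in contr_arcs Y A))
  (srcX1 : sources G \subset X1)
  (nb1 : no_backward X1 Y) (nb2 : no_backward Y X2) (nb12 : no_backward X1 X2) :
  isomorphic G (vrsp (contract Y) (contract2 X1 X2)).
Proof. by case: sync12 => sync2 sync1; apply: isomorphic_vrsp. Qed.
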